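(* Let $n\ge 4$ be an integer and suppose every downset $\mathcal{D}$ with $|U(\mathcal{D})|\le n-1$ has the star property. Then every downset $\mathcal{D}$ with $|U(\mathcal{D})|\le n$ has the star property if and only if the optimal objective value of the integer program $R_n$ is zero.
   Context: Let $[n]=\{1,\dots,n\}$ and $2^{[n]}$ its power set. $U(\mathcal{F})$ is the union of all sets in a family $\mathcal{F}$. A family $\mathcal{D}$ is a downset if $A\in\mathcal{D}$, $B\subseteq A$ imply $B\in\mathcal{D}$. A family is intersecting if any two of its sets have nonempty intersection; it is a star if some element of $U(\mathcal{F})$ lies in all its sets; $\mathcal{F}$ has the star property if some maximum-cardinality intersecting family contained in $\mathcal{F}$ is a star. The integer program $R_n$ has binary variables $x_S,y_S\in\{0,1\}$ for $S\in 2^{[n]}$ and $z\in\mathbb{Z}_{\ge0}$, objective $\max\sum_{S\in 2^{[n]}\setminus\{\emptyset\}} y_S - z$, and constraints: $y_T+y_S\le 1$ for all nonempty $S,T\in 2^{[n]}$ with $S\cap T=\emptyset$; $\sum_{S: i\in S} x_S\le z$ for all $i\in[n]$; $y_T\le x_S$ for all $S,T\in 2^{[n]}$ with $S\subseteq T$; $\sum_{S\ne\emptyset} 2y_S\le\sum_{S} x_S$; $y_S=0$ for all $S$ with $1\le|S|\le2$; $x_S=1$ for all $S$ with $|S|=1$; $x_S=1$ for all $S\subseteq[4]$.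
   Formalization: Proved for n ≥ 5: at n = 4 the claim fails, since every downset with at most 4 points has the star property but the optimal value of R_4 is −3. ''Every downset'' means every downset with nonempty union, as {} and {∅} contain no star of maximum size. *)

(* Defs.v *)
From mathcomp Require Import all_boot all_order all_algebra.

Set Implicit Arguments.
Unset Strict Implicit.
Unset Printing Implicit Defensive.

Import GRing.Theory Num.Theory.

(* U(F), the union of the members of F, is finset's [cover F]. *)

Definition downset (T : finType) (D : {set {set T}}) : Prop :=
  forall A B : {set T}, A \in D -> B \subset A -> B \in D.

(* The pair (A, A) is included, so the empty set is never a member of an
   intersecting family. *)
Definition intersecting (T : finType) (F : {set {set T}}) : Prop :=
  forall A B : {set T}, A \in F -> B \in F -> A :&: B != set0.

Definition star (T : finType) (F : {set {set T}}) : Prop :=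
  exists2 i : T, i \in cover F & forall A : {set T}, A \in F -> i \in A.

Definition max_intersecting (T : finType) (D F : {set {set T}}) : Prop :=
  [/\ F \subset D, intersecting F &
      forall G : {set {set T}},
        G \subset D -> intersecting G -> #|G| <= #|F|].

Definition star_property (T : finType) (D : {set {set T}}) : Prop :=
  exists2 F : {set {set T}}, max_intersecting D F & star F.

(* The downsets set0 and [set set0], whose union is empty, are left out: their
   only intersecting family is the empty one, which is not a star since its
   union has no element. *)
Definition downsets_have_star_property (m : nat) : Prop :=
  forall (T : finType) (D : {set {set T}}),
    downset D -> cover D != set0 -> #|cover D| <= m -> star_property D.

(* The ground set [n] is 'I_n = {0, .., n-1}; in particular [4] becomes the set
   of i : 'I_n with i < 4.  Binary variables are booleans, read as 0 or 1
   through the coercion to nat. *)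
Record R_feasible (n : nat) (x y : {set 'I_n} -> bool) (z : nat) : Prop :=
  RFeasible {
    R_disjoint : forall S T : {set 'I_n},
      S != set0 -> T != set0 -> S :&: T = set0 -> y T + y S <= 1;
    R_star : forall i : 'I_n, \sum_(S : {set 'I_n} | i \in S) x S <= z;
    R_downset : forall S T : {set 'I_n}, S \subset T -> y T <= x S;
    R_half :
      \sum_(S : {set 'I_n} | S != set0) 2 * y S <= \sum_(S : {set 'I_n}) x S;
    R_small : forall S : {set 'I_n}, 1 <= #|S| <= 2 -> y S = 0 :> nat;
    R_singleton : forall S : {set 'I_n}, #|S| = 1 -> x S = 1 :> nat;
    R_four : forall S : {set 'I_n},
      S \subset [set i : 'I_n | i < 4] -> x S = 1 :> nat
  }.

Definition R_objective (n : nat) (y : {set 'I_n} -> bool) (z : nat) : int :=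
  ((\sum_(S : {set 'I_n} | S != set0) y S)%N%:Z - z%:Z)%R.

(* For n = 4 the last constraint forces every x S to be 1, hence z >= 8, while at
   most 5 of the y S with S nonempty can be 1: the optimal value is then -3, not 0. *)
Definition R_optimal_value (n : nat) (v : int) : Prop :=
  (exists x y z, @R_feasible n x y z /\ R_objective y z = v) /\
  (forall x y z, @R_feasible n x y z -> (R_objective y z <= v)%R).

(* Main.v *)
(* A feasible point with positive objective yields, through the downset spanned
   by y, an intersecting family beating every star, so the value is at most 0 as
   soon as n-element downsets have the star property; 0 is attained by x = 1 and
   y = "S contains at least three of the first five points".

   Conversely let D be a downset on n points and F an intersecting subfamily
   larger than every star of D.  After relabelling, x = D, y = F, z = #|F| - 1 is
   feasible with objective 1.  By Kleitman's correlation inequality,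
   cross-intersecting subfamilies of two downsets have total size at most that
   of the larger downset.  This gives 2 #|F| <= #|D| and, applied to the links
   of a and b, shows that no pair {a, b} meets every member of F, and that a
   pair in D is missed by at least two of them.  So F has no sets of size at
   most 2.  Finally D has a set of size at least 4: otherwise F consists of
   triples.  If any two of them share at most one point, degree counting over
   one triple gives a large enough star.  If two of them share a pair {a, b},
   the triples missing a pair force F to contain abc, abd, cde, cdf, efa, efb;
   then F lives on these six points, has at most 10 members, and degree
   counting concludes again. *)
Require Import Defs.
From mathcomp Require Import all_boot all_order all_algebra.
From mathcomp Require Import zify.

Set Implicit Arguments.
Unset Strict Implicit.
Unset Printing Implicit Defensive.

(** * Links, deletions and correlation of downsets *)

Section Families.

Variable T : finType.
Implicit Types (a b i : T) (A B S W X : {set T}) (D E F G : {set {set T}}).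

Definition deletion a D := [set A in D | a \notin A].
Definition link a D := [set A : {set T} | (a \notin A) && (a |: A \in D)].
Definition degree D a := #|[set S in D | a \in S]|.

Lemma card_link a D : #|link a D| = degree D a.
Proof.
have inj : {in link a D &, injective (fun A => a |: A)}.
  move=> A B; rewrite !inE => /andP[aA _] /andP[aB _] eqAB.
  by rewrite -(setU1K aA) -(setU1K aB) eqAB.
rewrite /degree -(card_in_imset inj); apply: eq_card => S; rewrite inE.
apply/imsetP/andP => [[A] | [SD aS]].
  by rewrite inE => /andP[_ AD] ->; rewrite setU11.
by exists (S :\ a); rewrite ?inE ?eqxx setD1K.
Qed.

Lemma card_deletion_link a D : #|D| = #|deletion a D| + #|link a D|.
Proof.
rewrite card_link addnC -(cardsID [set S : {set T} | a \in S] D).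
by congr (_ + _); apply: eq_card => S; rewrite !inE // andbC.
Qed.

Lemma link_deletion a b D : a != b -> link b (deletion a D) = deletion a (link b D).
Proof.
move=> nab; apply/setP => A; rewrite !inE (negPf nab) /=.
by case: (b \in A); case: (_ \in D); case: (a \in A).
Qed.

Lemma linkS a D E : D \subset E -> link a D \subset link a E.
Proof.
move=> sDE; apply/subsetP => A; rewrite !inE => /andP[-> /(subsetP sDE) ->] //.
Qed.

Lemma deletionS a D E : D \subset E -> deletion a D \subset deletion a E.
Proof.
by move=> sDE; apply/subsetP => A; rewrite !inE => /andP[/(subsetP sDE) -> ->].
Qed.

Lemma downset_deletion a D : downset D -> downset (deletion a D).
Proof.
move=> dD A B; rewrite !inE => /andP[AD aA] sBA.
by rewrite (dD _ _ AD sBA) (contra (subsetP sBA a)).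
Qed.

Lemma downset_link a D : downset D -> downset (link a D).
Proof.
move=> dD A B; rewrite !inE => /andP[aA AD] sBA.
by rewrite (contra (subsetP sBA a)) //= (dD _ _ AD) // setUS.
Qed.

Lemma link_sub_deletion a D : downset D -> link a D \subset deletion a D.
Proof.
move=> dD; apply/subsetP => A; rewrite !inE => /andP[-> AD].
by rewrite (dD _ _ AD) // subsetUr.
Qed.

(* Kleitman's inequality for two decreasing families. *)
Lemma downset_correlation W D E : downset D -> downset E ->
  D \subset powerset W -> E \subset powerset W ->
  #|D| * #|E| <= 2 ^ #|W| * #|D :&: E|.
Proof.
move: {2}#|W| (erefl #|W|) => m; elim: m W D E => [|m IH] W D E.
  move/eqP; rewrite cards_eq0 => /eqP-> _ _.
  rewrite powerset0 cards0 mul1n !subset1 => /orP[]/eqP->; last by rewrite cards0.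
  by case/orP=> /eqP ->; rewrite ?cards0 ?muln0 // setIid !cards1.
move=> cW dD dE sD sE.
have [a aW] : exists a, a \in W by apply/card_gt0P; rewrite cW.
have cW' : #|W :\ a| = m by move: cW; rewrite (cardsD1 a) aW => -[].
have dsub D' : D' \subset powerset W -> deletion a D' \subset powerset (W :\ a).
  move=> s; apply/subsetP => A; rewrite !inE => /andP[/(subsetP s)].
  by rewrite inE subsetD1 => -> ->.
have lsub D' : D' \subset powerset W -> link a D' \subset powerset (W :\ a).
  move=> s; apply/subsetP => A; rewrite !inE => /andP[aA /(subsetP s)].
  by rewrite inE subsetD1 aA subUset => /andP[_ ->].
have := IH _ _ _ cW' (@downset_deletion a _ dD) (@downset_deletion a _ dE)
  (dsub _ sD) (dsub _ sE).
have := IH _ _ _ cW' (@downset_link a _ dD) (@downset_link a _ dE)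
  (lsub _ sD) (lsub _ sE).
have -> : deletion a D :&: deletion a E = deletion a (D :&: E).
  by apply/setP => A; rewrite !inE andbACA andbb.
have -> : link a D :&: link a E = link a (D :&: E).
  by apply/setP => A; rewrite !inE andbACA andbb.
have := subset_leq_card (@link_sub_deletion a _ dD).
have := subset_leq_card (@link_sub_deletion a _ dE).
rewrite cW cW' expnS (card_deletion_link a D) (card_deletion_link a E).
rewrite (card_deletion_link a (D :&: E)).
move: #|deletion a D| #|link a D| #|deletion a E| #|link a E| => d0 d1 e0 e1.
move: #|deletion a _| #|link a _| (2 ^ m) => c0 c1 q le_e le_d.
(* Since [d1 <= d0] and [e1 <= e0], Chebyshev's inequality (d0 + d1)(e0 + e1) <= 2(d0 e0 + d1 e1)
   closes the induction. *)
nia.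
Qed.

Definition cross_intersecting F G :=
  forall A B, A \in F -> B \in G -> A :&: B != set0.

(* With U the up-closure of F, correlation gives 2^|T| |F| <= |D| |U|, likewise
   for G; the two up-closures are cross-intersecting, so complementation shows
   that their sizes add up to at most 2^|T|. *)
Lemma card_cross_intersecting D E F G : downset D -> downset E ->
  F \subset D -> G \subset E -> cross_intersecting F G ->
  #|F| + #|G| <= maxn #|D| #|E|.
Proof.
move=> dD dE sFD sGE cFG.
pose up F := [set A : {set T} | [exists B in F, B \subset A]].
have bound D' F' : downset D' -> F' \subset D' ->
    #|F'| * 2 ^ #|T| <= #|D'| * #|up F'|.
  move=> dD' sF.
  (* The complement of an up-closure is a downset; correlating it with [D'] gives the reversed
     inequality for [D'] and [up F']. *)
  have dn : downset (~: up F').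
    move=> A B; rewrite !inE => nA sBA; apply: contra nA => /exists_inP[C CF sCB].
    by apply/exists_inP; exists C => //; apply: subset_trans sBA.
  have := @downset_correlation setT _ _ dD' dn.
  rewrite powersetT !subsetT cardsT => /(_ isT isT).
  have := cardsID (up F') D'; rewrite setDE.
  have := cardsC (up F'); rewrite -cardsT -powersetT card_powerset cardsT.
  have : #|F'| <= #|D' :&: up F'|.
    apply/subset_leq_card/subsetP => A AF; rewrite !inE (subsetP sF) //=.
    by apply/exists_inP; exists A.
  move: #|D' :&: ~: _| #|_ :&: _| #|~: _| #|up _| #|F'| #|D'| => x y p u f d.
  nia.
have upC : #|up F| + #|up G| <= 2 ^ #|T|.
  rewrite -cardsT -card_powerset powersetT cardsT -(cardsC (up F)) leq_add2l.
  rewrite -(card_imset _ (@setC_inj T)); apply/subset_leq_card/subsetP => ? /imsetP[A].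
  rewrite !inE => /exists_inP[B BG sBA] ->; apply/exists_inP => -[C CF sCA].
  case/negP: (cFG _ _ CF BG); rewrite setI_eq0 disjoints_subset.
  by rewrite (subset_trans sCA) // setCS.
have := bound _ _ dD sFD; have := bound _ _ dE sGE.
have : 0 < 2 ^ #|T| by rewrite expn_gt0.
move: #|F| #|G| #|D| #|E| (2 ^ #|T|) #|up F| #|up G| upC => f g d e q u v.
move=> *; have : (f + g) * q <= maxn d e * q by nia.
by rewrite leq_pmul2r.
Qed.

Lemma downset_cover D i : downset D -> (i \in cover D) = ([set i] \in D).
Proof.
move=> dD; apply/bigcupP/idP => [[A AD iA] | iD]; last by exists [set i]; rewrite ?inE.
by apply: dD AD _; rewrite sub1set.
Qed.

Lemma exchange_card (I J : finType) (A : {set I}) (B : {set J}) (r : I -> J -> bool) :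
  \sum_(i in A) #|[set j in B | r i j]| = \sum_(j in B) #|[set i in A | r i j]|.
Proof.
under eq_bigr => i _ do rewrite -sum1_card.
rewrite (exchange_big_dep (fun j => j \in B)) => [|i j _]; last by rewrite inE => /andP[].
apply: eq_bigr => j jB /=; rewrite sum1_card; apply: eq_card => i.
by rewrite unfold_in !inE jB.
Qed.

Lemma sum_degree F W : \sum_(i in W) degree F i = \sum_(S in F) #|S :&: W|.
Proof.
rewrite exchange_card; apply: eq_bigr => S _; apply: eq_card => i.
by rewrite !inE andbC.
Qed.

Lemma card_triple a b c : #|[set a; b; c]| = 3 -> [/\ a != b, a != c & b != c].
Proof.
have -> : [set a; b; c] = [set x in [:: a; b; c]].
  by apply/setP => x; rewrite !inE -orbA.
rewrite cardsE => /card_uniqP /=.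
by rewrite !inE negb_or andbT => /andP[/andP[-> ->] ->].
Qed.

Lemma triple_of_pair a b X : #|X| = 3 -> a != b -> a \in X -> b \in X ->
  exists c, X = [set a; b; c].
Proof.
move=> X3 nab aX bX.
have sub : [set a; b] \subset X by rewrite subUset !sub1set aX bX.
have /cards1P[c eX] : #|X :\: [set a; b]| == 1.
  by rewrite cardsD (setIidPr sub) X3 cards2 nab.
by exists c; rewrite -(setIidPr sub) -eX setID.
Qed.

(** * Intersecting families larger than every star *)

Section LargeIntersecting.

Variables D F : {set {set T}}.
Hypotheses (dD : downset D) (sFD : F \subset D) (iF : intersecting F).
Hypothesis degD : forall i, degree D i < #|F|.

Lemma card_double_le : 2 * #|F| <= #|D|.
Proof. by have := card_cross_intersecting dD dD sFD sFD iF; rewrite maxnn mul2n addnn. Qed.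

(* Splitting by {a, b}, the members of F through exactly one of a and b are
   bounded by cross-intersection by the larger of the corresponding parts of the
   stars of D at a and b. *)
Lemma pair_missed a b : a != b ->
  #|link b (link a D)| < #|link b (link a F)| + #|deletion b (deletion a F)|.
Proof.
move=> nab; have nba : b != a by rewrite eq_sym.
have cross : cross_intersecting (deletion b (link a F)) (deletion a (link b F)).
  move=> A B; rewrite !inE => /andP[/andP[aA AF] bA] /andP[/andP[bB BF] aB].
  case/set0Pn: (iF AF BF) => i; rewrite !inE => /andP[iA iB].
  apply/set0Pn; exists i; rewrite inE; move: iA iB.
  case: eqP => [-> _ | _ /=]; first by rewrite (negPf nab) (negPf aB).
  by case: eqP => [-> | _ /= -> -> //]; rewrite (negPf bA).
have := card_cross_intersecting (@downset_deletion b _ (@downset_link a _ dD))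
  (@downset_deletion a _ (@downset_link b _ dD))
  (deletionS b (linkS a sFD)) (deletionS a (linkS b sFD)) cross.
have := degD a; have := degD b; rewrite -!card_link.
have -> : #|F| = #|deletion b (deletion a F)| + #|deletion a (link b F)|
   + (#|deletion b (link a F)| + #|link b (link a F)|).
  by rewrite -link_deletion // -!card_deletion_link.
rewrite (card_deletion_link b (link a D)) (card_deletion_link a (link b D)).
have -> : link a (link b D) = link b (link a D).
  by apply/setP => A; rewrite !inE (negPf nab) (negPf nba) /= setUCA andbCA.
lia.
Qed.

(** A member {a} would put F inside the star of D at a. A member {a, b} would leave no member
    missing both points, and [pair_missed] would then make the double link of F larger than that of
    D. *)
Lemma member_card_gt2 S : S \in F -> 2 < #|S|.
Proof.
move=> SF; have nz B : B \in F -> S :&: B != set0 by apply: iF.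
case E : #|S| => [|[|[|k]]] //.
- by move: (nz S SF); rewrite setIid -cards_eq0 E.
- have /cards1P[a eS] : #|S| == 1 by rewrite E.
  have : #|F| <= degree D a.
    apply/subset_leq_card/subsetP => B BF; rewrite inE (subsetP sFD) //=.
    by have := nz B BF; rewrite eS setI_eq0 disjoints1 negbK.
  by rewrite leqNgt degD.
- have /cards2P[a [b [nab eS]]] : #|S| == 2 by rewrite E.
  have := pair_missed nab.
  have -> : deletion b (deletion a F) = set0.
    apply/setP => B; rewrite !inE; apply/negP => /andP[/andP[BF aB] bB].
    have := nz B BF; rewrite eS setI_eq0 disjoints_subset subUset !sub1set !inE.
    by rewrite aB bB.
  by rewrite cards0 addn0 ltnNge subset_leq_card // !linkS.
Qed.

(** The pair itself appears as [set0] in the double link of D but not in that of F, whose members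
    have at least three points. This strict inclusion raises the bound of [pair_missed] from one to
    two. *)
Lemma two_members_miss_pair a b : a != b -> [set a; b] \in D ->
  exists X Y, [/\ X \in F, Y \in F, X != Y &
    [/\ a \notin X, b \notin X, a \notin Y & b \notin Y]].
Proof.
move=> nab abD.
have : #|link b (link a F)| < #|link b (link a D)|.
  apply: proper_card; apply/properP; split; first exact/linkS/linkS; exists set0.
    by rewrite !inE !setU0 (negPf nab).
  rewrite !inE !setU0 (negPf nab) /=; apply/negP => /member_card_gt2.
  by rewrite cards2 nab.
have := pair_missed nab => lt1 lt2.
have /card_gt1P[X [Y [+ + nXY]]] : 1 < #|deletion b (deletion a F)| by lia.
rewrite !inE => /andP[/andP[? ?] ?] /andP[/andP[? ?] ?].
by exists X, Y; split.
Qed.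

(** * Downsets with members of at most three points *)

Hypothesis rank3 : forall S, S \in D -> #|S| <= 3.

Lemma member_card S : S \in F -> #|S| = 3.
Proof.
by move=> SF; apply/eqP; rewrite eqn_leq member_card_gt2 // rank3 // (subsetP sFD).
Qed.

Lemma triple_hit S a b c : S \in F -> [set a; b; c] \in F ->
  [|| a \in S, b \in S | c \in S].
Proof.
move=> SF abcF; case/set0Pn: (iF abcF SF) => i; rewrite !inE -orbA.
by case/andP => /or3P[] /eqP -> ->; rewrite ?orbT.
Qed.

(** A member missing a and b can meet abc only in c and abd only in d. *)
Lemma members_avoiding_pair a b c d : [set a; b; c] \in F -> [set a; b; d] \in F ->
  c != d -> exists e f, [/\ [set c; d; e] \in F, [set c; d; f] \in F, e != f &
    [/\ e != a, e != b, f != a & f != b]].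
Proof.
move=> abc abd ncd; have [nab _ _] := card_triple (member_card abc).
have abD : [set a; b] \in D.
  by apply: dD (subsetP sFD _ abc) _; rewrite subsetUl.
have [X [Y [XF YF nXY [aX bX aY bY]]]] := two_members_miss_pair nab abD.
have third Z : Z \in F -> a \notin Z -> b \notin Z -> exists e,
    [/\ Z = [set c; d; e], e != a & e != b].
  move=> ZF aZ bZ; have := triple_hit ZF abc; have := triple_hit ZF abd.
  rewrite (negPf aZ) (negPf bZ) /= => dZ cZ.
  have [e eZ] := triple_of_pair (member_card ZF) ncd cZ dZ.
  by exists e; split=> //; apply: contraTneq isT => ee;
    [move: aZ | move: bZ]; rewrite eZ ee !inE eqxx orbT.
have [e [eX nea neb]] := third X XF aX bX.
have [f [fY nfa nfb]] := third Y YF aY bY.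
exists e, f; rewrite -eX -fY; split=> //.
by apply: contraNneq nXY => ef; rewrite eX fY ef.
Qed.

Lemma six_triples a b c d e f : uniq [:: a; b; c; d; e; f] ->
  [set a; b; c] \in F -> [set a; b; d] \in F -> [set c; d; e] \in F ->
  [set c; d; f] \in F -> [set e; f; a] \in F -> [set e; f; b] \in F -> False.
Proof.
move=> us abc abd cde cdf efa efb; set s := [:: a; b; c; d; e; f] in us.
pose W := [set x in s].
have W6 : #|W| = 6 by rewrite cardsE; apply/card_uniqP.
have sFW S : S \in F -> S \subset W.
  (* Any set hitting all six triples has at least three points among the six, so a triple in F has
     no point outside W. *)
  move=> SF; have : 2 < count (mem S) s.
    move: (triple_hit SF abc) (triple_hit SF abd) (triple_hit SF cde)
      (triple_hit SF cdf) (triple_hit SF efa) (triple_hit SF efb) => /=.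
    by do 6!case: (_ \in S).
  have -> : count (mem S) s = #|S :&: W|.
    rewrite -size_filter -(card_uniqP _) ?filter_uniq // -cardsE.
    by apply: eq_card => x; rewrite inE mem_filter !inE.
  move=> le3; apply/setIidPl/eqP; rewrite eqEcard subsetIl.
  by rewrite (member_card SF).
(* Complementation in W maps F injectively to triples outside F. *)
have F10 : 2 * #|F| <= 20.
  have <- : #|[set A : {set T} | A \subset W & #|A| == 3]| = 20.
    by rewrite cards_draws W6.
  pose G := [set W :\: A | A in F].
  have cG : #|G| = #|F|.
    apply: card_in_imset => A B AF BF eAB.
    have compl2 C : C \in F -> W :\: (W :\: C) = C.
      by move=> CF; rewrite setDDr setDv set0U; apply/setIidPr/sFW.
    by rewrite -(compl2 A AF) eAB compl2.
  rewrite mul2n -addnn -{2}cG.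
  have /eqP <- : #|F :|: G| == #|F| + #|G|.
    rewrite (leq_card_setU F G) -setI_eq0; apply/set0Pn => -[A].
    rewrite inE => /andP[AF /imsetP[B BF eA]].
    by case/negP: (iF AF BF); rewrite eA setIC setIDA setDIl setDv set0I.
  apply/subset_leq_card/subsetP => A; rewrite !inE => /orP[AF | /imsetP[B BF ->]].
    by rewrite sFW //= member_card.
  by rewrite subsetDl cardsD (setIidPr (sFW _ BF)) W6 member_card.
(* The six triples cover all pairs of points of W. The case [v = w] gives the singletons. *)
have pairW v w : v \in W -> w \in W -> [set v; w] \in D.
  rewrite !inE => vs ws.
  have /hasP[S SL /andP[vS wS]] : has (fun S => (v \in S) && (w \in S))
    [:: [set a; b; c]; [set a; b; d]; [set c; d; e]; [set c; d; f];
        [set e; f; a]; [set e; f; b]].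
    move: vs ws; rewrite /= !inE => vs ws.
    move: vs; do 5?[case/orP => [/eqP-> |]]; last move/eqP->;
      move: ws; (do 5?[case/orP => [/eqP-> |]]; last move/eqP->);
      by rewrite !eqxx !orbT.
  have SD : S \in D.
    apply: (subsetP sFD); move: SL; rewrite !inE.
    by do 5?[case/orP]; move/eqP->.
  by apply: dD SD _; rewrite subUset !sub1set vS wS.
(* Besides the triples of F, the star of D at v contains {v} and the five pairs joining v to the
   rest of W. *)
have degW v : v \in W -> degree F v + 6 <= degree D v.
  move=> vW; pose P := [set [set v; w] | w in W].
  have <- : #|P| = 6.
    rewrite -W6; apply: card_in_imset => x y _ _ /setP exy.
    move: (exy x) (exy y); rewrite !inE !eqxx !orbT (eq_sym y x).
    by case: (x =P y) => // _; rewrite !orbF => /esym/eqP-> /eqP->.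
  have /eqP <- : #|[set S in F | v \in S] :|: P| == degree F v + #|P|.
    rewrite (leq_card_setU _ P) -setI_eq0; apply/set0Pn => -[A].
    rewrite !inE => /andP[/andP[AF _] /imsetP[w _ eA]].
    by have := member_card AF; rewrite eA cards2; case: (_ != _).
  apply/subset_leq_card/subsetP => A; rewrite !inE.
  case/orP => [/andP[AF ->] | /imsetP[w wW ->]]; first by rewrite (subsetP sFD).
  by rewrite pairW // !inE eqxx.
(* Each point of F lies in W, so the degrees sum to 3|F|; then 3|F| + 42 <= 6|F| forces |F| >= 14,
   against |F| <= 10. *)
have : \sum_(v in W) (degree F v + 7) <= \sum_(v in W) #|F|.
  apply: leq_sum => v vW; have := degD v; have := degW v vW; lia.
rewrite big_split /= sum_degree !sum_nat_const W6.
rewrite (eq_bigr (fun=> 3)) ?sum_nat_const => [|S SF]; first by move: #|F| F10 => k; lia.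
by rewrite (setIidPl (sFW S SF)) member_card.
Qed.

(** Each member of F through i brings itself and two pairs {i, j} into the star of D. No pair is
    brought twice, as distinct members share at most one point; {i} makes the inequality strict. *)
Lemma linear_degree i : i \in cover F ->
  (forall A B, A \in F -> B \in F -> A != B -> #|A :&: B| <= 1) ->
  3 * degree F i < degree D i.
Proof.
case/bigcupP => S0 S0F iS0 lin.
pose Fi := [set S in F | i \in S].
pose Q := [set X in D | (i \in X) && (#|X| == 2)].
have card2 X : X \in Q -> #|X| = 2 by rewrite inE => /and3P[_ _ /eqP].
have le2 S : S \in Fi -> 2 <= #|[set X in Q | X \subset S]|.
  rewrite inE => /andP[SF iS].
  have <- : #|[set [set i; j] | j in S :\ i]| = 2.
    have -> : 2 = #|S :\ i| by have := cardsD1 i S; rewrite iS member_card // => -[].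
    apply: card_in_imset => x y; rewrite !inE => /andP[nx _] /andP[ny _] /setP/(_ x).
    by rewrite !inE eqxx orbT (negPf nx) => /esym/eqP.
  apply/subset_leq_card/subsetP => X /imsetP[j]; rewrite !inE => /andP[nji jS] ->.
  have sS : [set i; j] \subset S by rewrite subUset !sub1set iS jS.
  by rewrite sS (dD (subsetP sFD _ SF) sS) !inE eqxx cards2 eq_sym nji.
have le1 X : X \in Q -> #|[set S in Fi | X \subset S]| <= 1.
  move=> XQ; apply/card_le1_eqP => A B; rewrite !inE.
  move=> /andP[/andP[AF _] XA] /andP[/andP[BF _] XB].
  apply/eqP/contraT => nAB; have := lin B A BF AF nAB.
  rewrite leqNgt -(card2 X XQ) => /negP[].
  by apply: subset_leq_card; rewrite subsetI XB XA.
have dQ : degree F i * 2 <= #|Q|.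
  have : \sum_(X in Q) #|[set S in Fi | X \subset S]| <= \sum_(X in Q) 1.
    exact: leq_sum.
  rewrite -exchange_card sum_nat_const muln1.
  by apply: leq_trans; rewrite -sum_nat_const; apply: leq_sum.
have /eqP eFQ : #|Fi :|: Q| == #|Fi| + #|Q|.
  rewrite (leq_card_setU Fi Q) -setI_eq0; apply/set0Pn => -[X].
  rewrite inE => /andP[/[1!inE] /andP[XF _] /card2].
  by rewrite member_card.
have iFQ : [set i] \notin Fi :|: Q.
  by rewrite !inE cards1 !andbF orbF; apply/negP => /andP[/member_card]; rewrite cards1.
have : #|[set i] |: (Fi :|: Q)| <= degree D i.
  apply/subset_leq_card/subsetP => X; rewrite !inE.
  case/or3P => [/eqP-> | /andP[/(subsetP sFD)-> ->] // | /and3P[-> ->] //].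
  by rewrite (dD (subsetP sFD _ S0F)) ?sub1set // inE eqxx.
rewrite cardsU1 iFQ eFQ; change #|Fi| with (degree F i); lia.
Qed.

Lemma rank3_family_empty : F = set0.
Proof.
case: (set_0Vmem F) => // -[A AF]; exfalso.
have [/exists_inP[X XF /exists_inP[Y YF /andP[nXY XY]]] | /exists_inPn lin] :=
    boolP [exists X in F, exists Y in F, (X != Y) && (1 < #|X :&: Y|)].
  have XY2 : #|X :&: Y| = 2.
    apply/eqP; rewrite eqn_leq XY andbT leqNgt; apply: contra nXY => XY3.
    have sXY : X \subset Y.
      by apply/setIidPl/eqP; rewrite eqEcard subsetIl member_card.
    by rewrite eqEcard sXY !member_card.
  have /cards2P[a [b [nab eXY]]] : #|X :&: Y| == 2 by rewrite XY2.
  have : [set a; b] \subset X :&: Y by rewrite eXY.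
  rewrite subsetI !subUset !sub1set => /andP[/andP[aX bX] /andP[aY bY]].
  have [c eX] := triple_of_pair (member_card XF) nab aX bX.
  have [d eY] := triple_of_pair (member_card YF) nab aY bY.
  subst X Y; have ncd : c != d by apply: contraNneq nXY => ->.
  have [e [f [cde cdf nef [nea neb nfa nfb]]]] := members_avoiding_pair XF YF ncd.
  (* Applied again, now to the pair {c, d}: the third points g and h must hit abc, hence are a and b
     in some order. *)
  have [g [h [efg efh ngh [ngc ngd nhc nhd]]]] := members_avoiding_pair cde cdf nef.
  have [_ nac nbc] := card_triple (member_card XF).
  have [_ nad nbd] := card_triple (member_card YF).
  have [_ nce nde] := card_triple (member_card cde).
  have [_ ncf ndf] := card_triple (member_card cdf).
  have ab k : [set e; f; k] \in F -> k != c -> (k == a) || (k == b).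
    move=> efk nkc; have := triple_hit efk XF.
    rewrite !inE !(eq_sym _ e, eq_sym _ f, eq_sym _ k).
    by rewrite (negPf nea) (negPf neb) (negPf nfa) (negPf nfb) (negPf nkc)
      (eq_sym e c) (negPf nce) (eq_sym f c) (negPf ncf) !orbF.
  have [efa efb] : [set e; f; a] \in F /\ [set e; f; b] \in F.
    case/orP: (ab g efg ngc) (efg) (ngh) => /eqP->;
      by case/orP: (ab h efh nhc) (efh) => /eqP->; rewrite ?eqxx.
  apply: (six_triples _ XF YF cde cdf efa efb).
  rewrite /= !inE !negb_or nab nac nad (eq_sym a e) nea (eq_sym a f) nfa.
  by rewrite nbc nbd (eq_sym b e) neb (eq_sym b f) nfb ncd nce ncf nde ndf nef.
have {}lin X Y : X \in F -> Y \in F -> X != Y -> #|X :&: Y| <= 1.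
  move=> XF YF nXY; move: (lin X XF); rewrite negb_exists_in => /forall_inP/(_ Y YF).
  by rewrite nXY /= -leqNgt.
(* Over the triple A, the degrees in F sum to at least |F| + 2: A contributes 3 and every other
   member at least 1. This gives 3(|F| + 2) + 6 <= 3|F|, which is absurd. *)
have : \sum_(i in A) (3 * degree F i + 2) <= \sum_(i in A) #|F|.
  apply: leq_sum => i iA; have := degD i.
  have := linear_degree _ lin (i := i); rewrite (_ : i \in cover F).
    by move=> /(_ isT); lia.
  by apply/bigcupP; exists A.
rewrite big_split /= -big_distrr /= sum_degree !sum_nat_const member_card //.
have : #|F| + 2 <= \sum_(S in F) #|S :&: A|.
  rewrite (cardsD1 A) AF (bigD1 A) //= setIid member_card //.
  have : \sum_(S in F | S != A) 1 <= \sum_(S in F | S != A) #|S :&: A|.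
    by apply: leq_sum => S /andP[SF _]; rewrite lt0n cards_eq0 iF.
  rewrite sum1_card (eq_card (B := F :\ A)) => [|S]; last by rewrite !inE andbC.
  by rewrite addnAC => le_sum; apply: leq_add.
move: (\sum_(S in F) _) #|F| => s k; lia.
Qed.

End LargeIntersecting.
End Families.

(** * From large families to feasible points *)

(** Compare a maximum intersecting family with the stars of D: a star at least as large is itself
    maximum. *)
Lemma star_or_large (T : finType) (D : {set {set T}}) : downset D -> cover D != set0 ->
  star_property D \/ exists F : {set {set T}},
    [/\ F \subset D, intersecting F, F != set0 & forall i, degree D i < #|F|].
Proof.
move=> dD /set0Pn[j /bigcupP[S0 S0D jS0]].
pose ok (F : {set {set T}}) :=
  (F \subset D) && [forall A in F, [forall B in F, A :&: B != set0]].
have okP (F : {set {set T}}) : reflect (F \subset D /\ intersecting F) (ok F).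
  apply: (iffP andP) => -[sFD iF]; split=> //.
    by move=> A B AF BF; move/forall_inP/(_ A AF)/forall_inP: iF; apply.
  by apply/forall_inP => A AF; apply/forall_inP => B; apply: iF.
have ok0 : ok set0 by apply/okP; split; [apply: sub0set | move=> A B; rewrite inE].
case: (arg_maxnP (fun F : {set {set T}} => #|F|) ok0) => F /okP[sFD iF] maxF.
have max_star i : ok [set S in D | i \in S].
  apply/okP; split; first by apply/subsetP => S; rewrite inE => /andP[].
  move=> A B; rewrite !inE => /andP[_ iA] /andP[_ iB].
  by apply/set0Pn; exists i; rewrite inE iA.
have F0 : 0 < #|F|.
  apply: leq_trans (maxF _ (max_star j)); apply/card_gt0P; exists S0.
  by rewrite inE S0D.
have [/existsP[i le_i] | /existsPn deg_lt] := boolP [exists i, #|F| <= degree D i].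
  left; have /okP[sub int] := max_star i.
  exists [set S in D | i \in S]; last first.
    exists i => [|A]; last by rewrite inE => /andP[].
    have /card_gt0P[S Si] := leq_trans F0 le_i.
    by apply/bigcupP; exists S => //; move: Si; rewrite inE => /andP[].
  split=> // G sGD iG; apply: leq_trans le_i; apply: maxF.
  exact/okP.
right; exists F; split=> // [|i]; first by rewrite -card_gt0.
by rewrite ltnNge.
Qed.

Lemma sum_bool (I : finType) (P p : pred I) :
  \sum_(i | P i) p i = #|[set i | P i && p i]|.
Proof.
by rewrite -sum1dep_card big_mkcondr; apply: eq_bigr => i _; case: (p i).
Qed.

(** All stars of D being smaller than F, [z] can be one less than |F|, which leaves objective 1. *)
Lemma feasible_of_family (n : nat) (D F : {set {set 'I_n}}) :
  downset D -> F \subset D -> intersecting F -> (forall i, degree D i < #|F|) ->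
  (forall i, [set i] \in D) -> [set i : 'I_n | i < 4] \in D ->
  R_feasible (fun S => S \in D) (fun S => S \in F) #|F|.-1.
Proof.
move=> dD sFD iF degD singD fourD.
have F0 : set0 \notin F by apply/negP => F0; have := iF _ _ F0 F0; rewrite setI0 eqxx.
split.
- move=> S T _ _ ST; case SF: (S \in F); case TF: (T \in F) => //.
  by have := iF _ _ SF TF; rewrite ST eqxx.
- move=> i; rewrite sum_bool.
  have -> : #|[set S : {set 'I_n} | (i \in S) && (S \in D)]| = degree D i.
    by apply: eq_card => S; rewrite !inE andbC.
  by have := degD i; case: #|F|.
- move=> S T sST; case TF: (T \in F) => //.
  by rewrite (dD _ _ (subsetP sFD _ TF) sST).
- rewrite -big_distrr /= !sum_bool.
  have -> : [set S | (S != set0) && (S \in F)] = F.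
    apply/setP => S; rewrite inE andb_idl // => SF.
    by apply: contraNneq F0 => <-.
  have -> : [set S : {set 'I_n} | true && (S \in D)] = D by apply/setP => S; rewrite inE.
  exact: card_double_le.
- move=> S /andP[_]; case SF: (S \in F) => //.
  by rewrite leqNgt (member_card_gt2 dD sFD iF degD).
- by move=> S /eqP/cards1P[i ->]; rewrite singD.
- by move=> S /(dD _ _ fourD) ->.
Qed.

(** This relabels the points of a downset so that the first k labels fall in a chosen member; with k
    = 4 it secures the constraint [R_four]. *)
Lemma enumeration_from (T : finType) (C A : {set T}) (k : nat) :
  A \subset C -> k <= #|A| -> exists f : 'I_#|C| -> T,
  [/\ injective f, f @: setT = C & f @: [set i : 'I_#|C| | i < k] \subset A].
Proof.
move=> sAC kA; pose s := enum A ++ enum (C :\: A).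
have us : uniq s.
  rewrite cat_uniq !enum_uniq andbT /=; apply/hasPn => x.
  by rewrite !mem_enum !inE => /andP[].
have ms : s =i C.
  by move=> x; rewrite mem_cat !mem_enum inE; case: (boolP (x \in A)) => // /(subsetP sAC).
have ss : size s = #|C| by rewrite -(card_uniqP us) (eq_card ms).
pose f (i : 'I_#|C|) := tnth (in_tuple s) (cast_ord (esym ss) i).
have fE x0 i : f i = nth x0 s i by rewrite /f (tnth_nth x0).
exists f; split.
- move=> i j; rewrite (fE (f i) i) (fE (f i) j) => /eqP.
  by rewrite nth_uniq ?ss // => /eqP/val_inj.
- apply/setP => x; rewrite -ms; apply/imsetP/idP => [[i _ ->] | xs].
    by rewrite (fE (f i)) mem_nth // ss.
  have lt_x : index x s < #|C| by rewrite -ss index_mem.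
  by exists (Ordinal lt_x); rewrite // (fE x) nth_index.
- apply/subsetP => x /imsetP[i]; rewrite inE => ik ->.
  by rewrite (fE (f i)) nth_cat -cardE (leq_trans ik kA) -mem_enum mem_nth // -cardE (leq_trans ik).
Qed.

Lemma feasible_of_large (T : finType) (D F : {set {set T}}) (A : {set T}) :
  downset D -> F \subset D -> intersecting F -> (forall i, degree D i < #|F|) ->
  A \in D -> 4 <= #|A| ->
  exists x y z, @R_feasible #|cover D| x y z /\ \sum_(S | S != set0) y S = z.+1.
Proof.
move=> dD sFD iF degD AD A4.
have sAC : A \subset cover D := bigcup_sup A AD.
have [f [fI fC fA]] := enumeration_from sAC A4.
pose pre (G : {set {set T}}) := [set S : {set 'I_#|cover D|} | f @: S \in G].
(* Members of D lie in [cover D], the image of f, so pulling back along f loses none of them. *)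
have card_pre (G : {set {set T}}) : G \subset D -> #|pre G| = #|G|.
  move=> sGD; rewrite -(card_imset _ (imset_inj fI)); apply: eq_card => S.
  apply/imsetP/idP => [[X] | SG]; first by rewrite inE => ? ->.
  have sSC : S \subset f @: setT by rewrite fC (bigcup_sup S (subsetP sGD _ SG)).
  have eS : f @: (f @^-1: S) = S.
    apply/setP => x; apply/imsetP/idP => [[i] | xS]; first by rewrite inE => ? ->.
    have /imsetP[i _ xi] := subsetP sSC _ xS.
    by exists i; rewrite // inE -xi.
  by exists (f @^-1: S); rewrite ?inE eS.
have Fpos : 0 < #|pre F|.
  by rewrite card_pre //; case: (set_0Vmem A) A4 => [-> | [i _] _];
    [rewrite cards0 | apply: leq_trans (degD i)].
have F0 : set0 \notin F by apply/negP => F0; have := iF _ _ F0 F0; rewrite setI0 eqxx.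
exists (fun S => S \in pre D), (fun S => S \in pre F), #|pre F|.-1; split; last first.
  rewrite sum_bool prednK //; apply: eq_card => S; rewrite !inE andb_idl // => SF.
  by apply: contraNneq F0 => S0; rewrite S0 imset0 in SF.
apply: feasible_of_family.
- by move=> X Y; rewrite !inE => XD sYX; apply: dD XD _; apply: imsetS.
- by apply/subsetP => X; rewrite !inE => /(subsetP sFD).
- move=> X Y; rewrite !inE => XF YF; apply: contraNneq (iF _ _ XF YF) => XY.
  by rewrite -imsetI ?XY ?imset0 // => ? ? _ _; apply: fI.
- move=> i; rewrite card_pre //; apply: leq_ltn_trans (degD (f i)).
  rewrite /degree -[X in _ <= X]card_pre; last by apply/subsetP => S /[1!inE] /andP[].
  apply/subset_leq_card/subsetP => S; rewrite !inE => /andP[-> iS].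
  by rewrite imset_f.
- move=> i; rewrite inE imset_set1 -(downset_cover _ dD) -fC.
  exact: imset_f.
- by rewrite inE (dD _ _ AD fA).
Qed.

(** * The value 0 as upper bound and as attained value *)

(** On the downset spanned by the nonempty sets with y = 1, x is 1 as well. A maximum intersecting
    family there is a star at some i, so it is counted by the sum of x at i, at most [z]. *)
Lemma objective_le0 (n : nat) (x y : {set 'I_n} -> bool) (z : nat) :
  downsets_have_star_property n -> R_feasible x y z -> \sum_(S | S != set0) y S <= z.
Proof.
move=> star_n [disj degx down _ _ _ _].
rewrite sum_bool; set F := [set S | _].
have FP S : S \in F -> S != set0 /\ y S by rewrite inE => /andP[].
pose D := [set S : {set 'I_n} | [exists A in F, S \subset A]].
have sFD : F \subset D by apply/subsetP => S SF; rewrite inE; apply/exists_inP; exists S.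
have iF : intersecting F.
  move=> A B /FP[A0 yA] /FP[B0 yB]; apply/eqP => AB.
  by have := disj A B A0 B0 AB; rewrite yA yB.
have dD : downset D.
  move=> A B; rewrite !inE => /exists_inP[C CF sAC] sBA; apply/exists_inP.
  by exists C; rewrite ?(subset_trans sBA).
have Dx S : S \in D -> x S.
  rewrite inE => /exists_inP[A /FP[_ yA] sSA].
  by have := down S A sSA; rewrite yA; case: (x S).
have [-> | [A AF]] := set_0Vmem F; first by rewrite cards0.
have cD : cover D != set0.
  have [/set0Pn[i iA] _] := FP A AF; apply/set0Pn; exists i.
  by apply/bigcupP; exists A; rewrite ?(subsetP sFD).
have [|G [sGD iG maxG] [i _ Gi]] := star_n _ D dD cD.
  by rewrite -[X in _ <= X]card_ord max_card.
apply: leq_trans (maxG F sFD iF) (leq_trans _ (degx i)).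
rewrite sum_bool; apply/subset_leq_card/subsetP => S SG.
by rewrite inE Gi // Dx // (subsetP sGD).
Qed.

Lemma card_half_powerset (T : finType) (p : pred {set T}) :
  (forall S, p (~: S) = ~~ p S) -> 2 * #|[set S | p S]| = 2 ^ #|T|.
Proof.
move=> pC; rewrite -cardsT -card_powerset powersetT cardsT -(cardsC [set S | p S]).
rewrite mul2n -addnn; congr (_ + _); rewrite -(card_imset _ (@setC_inj T)).
apply: eq_card => S; rewrite !inE; apply/imsetP/idP => [[A + ->] | nS].
  by rewrite inE pC negbK.
by exists (~: S); rewrite ?setCK // inE pC.
Qed.

Lemma value0_feasible (n : nat) : 5 <= n ->
  exists x y z, @R_feasible n x y z /\ \sum_(S | S != set0) y S = z.
Proof.
(* Majority on five points: an odd size makes y hold for exactly one of S and its complement, and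
   five is the least for which majorities have more than two points. *)
move=> n5; pose W := [set i : 'I_n | i < 5].
have W5 : #|W| = 5.
  rewrite -sum1dep_card (big_ord_narrow n5) /=.
  by rewrite sum1_card card_ord.
pose y (S : {set 'I_n}) := 2 < #|S :&: W|.
have yC S : y (~: S) = ~~ y S.
  rewrite /y -leqNgt; have := cardsID S W; rewrite setDE W5 ![W :&: _]setIC.
  move: #|S :&: W| #|~: S :&: W| => k l kl; apply/idP/idP; lia.
have y0 : y set0 = false by rewrite /y set0I cards0.
have sumy : \sum_(S : {set 'I_n} | S != set0) y S = #|[set S | y S]|.
  rewrite sum_bool; apply: eq_card => S; rewrite !inE andb_idl // => yS.
  by apply: contraTneq yS => ->; rewrite y0.
have y2 := card_half_powerset yC.
exists (fun=> true), y, #|[set S | y S]|; split=> //; split=> //.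
- move=> S T _ _ ST; have : ~~ (y S && y T).
    rewrite /y; have : #|S :&: W| + #|T :&: W| <= #|W|.
      have /eqP <- : #|S :&: W :|: T :&: W| == #|S :&: W| + #|T :&: W|.
        by rewrite (leq_card_setU _ (T :&: W)) -setI_eq0 setIACA ST set0I.
      by rewrite subset_leq_card // subUset !subsetIr.
    by rewrite W5; lia.
  by case: (y S); case: (y T).
(* With x = 1, the sum at i counts half of all subsets, exactly as many as satisfy y. *)
- move=> i; rewrite sum_bool.
  have := @card_half_powerset _ (fun S : {set 'I_n} => i \in S).
  rewrite -y2 => /(_ _)/eqP; rewrite eqn_pmul2l // => h.
  rewrite -(eqP (h _)) => [|S]; last by rewrite inE.
  by apply/subset_leq_card/subsetP => S; rewrite !inE andbT.
- by move=> S T _; case: (y T).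
- rewrite -big_distrr /= sumy y2 sum1dep_card -[#|'I_n|]cardsT -card_powerset powersetT.
  by apply/subset_leq_card/subsetP => S _; rewrite inE.
- move=> S /andP[_ S2]; have : ~~ y S; last by case: (y S).
  by rewrite /y -leqNgt (leq_trans _ S2) // subset_leq_card // subsetIl.
Qed.

Theorem theorem2p14 (n : nat) (hn : 5 <= n)
    (hsmall : downsets_have_star_property (n - 1)) :
  downsets_have_star_property n <-> R_optimal_value n 0%R.
Proof.
split=> [star_n | [_ opt] T D dD cD leD].
  split=> [|x y z feas].
    have [x [y [z [feas e]]]] := value0_feasible hn.
    by exists x, y, z; split; rewrite // /R_objective e GRing.subrr.
  by rewrite /R_objective Num.Theory.subr_le0 lez_nat (objective_le0 star_n feas).
(* Only covers of exactly n points remain after [hsmall], so that relabelling lands in the program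
   for n itself. *)
have [le_small | gt_small] := leqP #|cover D| (n - 1); first exact: hsmall.
have en : #|cover D| = n by lia.
have [// | [F [sFD iF F0 degD]]] := star_or_large dD cD.
have [/exists_inP[A AD A4] | /exists_inPn small] := boolP [exists A in D, 3 < #|A|].
  have := feasible_of_large dD sFD iF degD AD A4; rewrite en.
  case=> x [y [z [feas e]]]; have := opt x y z feas.
  by rewrite /R_objective e Num.Theory.subr_le0 lez_nat ltnn.
case/eqP: F0; apply: (rank3_family_empty dD sFD iF degD) => S SD.
by rewrite leqNgt small.
Qed.
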